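(* Let $X$ be a metric space and let $\mathcal U=\{U_s\}_{s\in S}$ be a cover of $X$ of finite multiplicity. The following conditions are equivalent: 1. $\mathcal U$ is coarse. 2. There is a continuous slowly oscillating partition of unity $\phi=\{\phi_s\}_{s\in S}$ on $X\setminus A$, for some bounded subset $A$ of $X$, such that $\mathrm{Carr}(\phi_s)\subset U_s$ for each $s\in S$. 3. There is a slowly oscillating partition of unity $\phi=\{\phi_s\}_{s\in S}$ on $X\setminus A$, for some bounded subset $A$ of $X$, such that $\mathrm{Carr}(\phi_s)\subset U_s$ for each $s\in S$.
   Context: For points of a metric space $(X,d)$, $x_k\to\infty$ means $d(x_k,x_0)\to\infty$ for some (hence every) $x_0$. For a family $\mathcal U$ of subsets of $X$, $L_{\mathcal U}(x)=\sup_{U\in\mathcal U}\mathrm{dist}(x,X\setminus U)\in[0,\infty]$, with $\mathrm{dist}(x,\emptyset)=\infty$ and the supremum over the empty family equal to $0$; the Lebesgue number is $L(\mathcal U,X)=\inf_{x\in X}L_{\mathcal U}(x)$. $\mathcal U$ is coarse if $L_{\mathcal U}(x_k)\to\infty$ whenever $x_k\to\infty$. The multiplicity of $\{U_s\}_{s\in S}$ is the supremum over $x$ of the number of $s\in S$ with $x\in U_s$. A function $f:X\to Y$ of metric spaces (not assumed continuous) is slowly oscillating if $f^{-1}(\mathcal W)=\{f^{-1}(W)\}_{W\in\mathcal W}$ is a coarse family in $X$ for every cover $\mathcal W$ of $Y$ with positive Lebesgue number $L(\mathcal W,Y)>0$. A partition of unity on a space $Z$ is a family $\phi=\{\phi_s:Z\to[0,\infty)\}_{s\in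 S}$ of functions (not assumed continuous) with $\sum_{s\in S}\phi_s(z)=1$ for all $z\in Z$; it is continuous if all $\phi_s$ are continuous. It is slowly oscillating if the induced map $Z\to \ell^1_S$, $z\mapsto(\phi_s(z))_{s\in S}$, is slowly oscillating ($Z$ a metric space; $\ell^1_S$ with its norm metric). $\mathrm{Carr}(\phi_s)=\phi_s^{-1}(0,\infty)$. Subsets of $X$, such as $X\setminus A$, carry the restricted metric. *)

(* Defs.v *)
From HB Require Import structures.
From mathcomp Require Import all_boot all_order all_algebra.
From mathcomp Require Import all_classical all_reals all_analysis.

Set Implicit Arguments.
Unset Strict Implicit.
Unset Printing Implicit Defensive.

Import Order.TTheory GRing.Theory Num.Theory.
Import numFieldNormedType.Exports.

Local Open Scope classical_set_scope.
Local Open Scope ring_scope.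

(* The library equips the type of points of [D : set X] with the pseudometric
   restricted from [X]; this adds the compatible distance. *)
Section restricted_metric.
Context {R : realType} {X : metricType R} (D : set X).

Let dist (x y : D) : R := mdist (set_val x) (set_val y).

Let dist_ge0 x y : 0 <= dist x y.
Proof. exact: mdist_ge0. Qed.

Let dist_positivity x y : dist x y = 0 -> x = y.
Proof. by move=> /mdist_positivity/val_inj. Qed.

Let ballEdist (x : D) (e : R) : ball x e = [set y | dist x y < e].
Proof. by rewrite -initial_ballE ballEmdist. Qed.

HB.instance Definition _ := @PseudoMetric_isMetric.Build R (D : Type)
  dist dist_ge0 dist_positivity ballEdist.

End restricted_metric.

Section ell1.
Context (R : realType) (S : choiceType).

Record ell1 := Ell1 {
  ell1_val :> S -> R ;
  ell1_summable : `[< summable [set: S] (EFin \o ell1_val) >] }.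

HB.instance Definition _ := [isSub for ell1_val].
HB.instance Definition _ := [Choice of ell1 by <:].

Definition ell1_norm (u : S -> R) : R := fine (\esum_(s in [set: S]) `|u s|%:E).

Let dist (u v : ell1) : R := ell1_norm (fun s => u s - v s).

Let summableB' (u v : ell1) :
  (\esum_(s in [set: S]) `|u s - v s|%:E < +oo)%E.
Proof.
have := summableB (asboolW (ell1_summable u)) (asboolW (ell1_summable v)).
by rewrite /summable; apply: le_lt_trans; apply: le_esum.
Qed.

Let summableB_fin (u v : ell1) :
  \esum_(s in [set: S]) `|u s - v s|%:E \is a fin_num.
Proof.
by rewrite ge0_fin_numE ?summableB'// esum_ge0// => s _; rewrite lee_fin.
Qed.

Let distxx u : dist u u = 0.
Proof. by rewrite /dist /ell1_norm esum1// => s _; rewrite subrr normr0. Qed.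

Let dist_positivity u v : dist u v = 0 -> u = v.
Proof.
rewrite /dist /ell1_norm => uv0; apply: val_inj; apply/funext => s.
have {}uv0 : \esum_(s in [set: S]) `|u s - v s|%:E = 0%E.
  by rewrite -(fineK (summableB_fin u v)) uv0.
apply/eqP; rewrite -subr_eq0 -normr_le0 -lee_fin.
rewrite -[leRHS]uv0 (esumID [set s])// setTI esum_set1// leeDl//.
by rewrite esum_ge0// => ? _; rewrite lee_fin.
Qed.

Let dist_sym u v : dist u v = dist v u.
Proof. by congr fine; apply: eq_esum => s _; rewrite distrC. Qed.

Let dist_triangle v u w : dist u w <= dist u v + dist v w.
Proof.
rewrite /dist /ell1_norm -fineD// fine_le ?fin_numD ?summableB_fin//.
rewrite -esumD//; apply: le_esum => s _; rewrite lee_fin.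
exact: ler_distD.
Qed.

HB.instance Definition _ :=
  isMetric.Build R ell1 distxx dist_positivity dist_sym dist_triangle.

End ell1.

Section coarse.
Context {R : realType}.

Definition mbounded (X : metricType R) (A : set X) : Prop :=
  exists M : R, forall x y, A x -> A y -> mdist x y <= M.

Definition tends_to_infty (X : metricType R) (u : nat -> X) : Prop :=
  exists x0, mdist (u k) x0 @[k --> \oo] --> +oo.

(* [edist], hence the distance to a set [edist_inf] used below, is the library
   extended distance defined from balls. *)
Lemma edist_mdist (X : metricType R) (x y : X) :
  edist (x, y) = (mdist x y)%:E.
Proof.
apply/eqP; rewrite eq_le; apply/andP; split; last first.
  apply: le_ereal_inf_tmp => _ [r [_ /= xy] <-].
  by move: xy; rewrite ballEmdist /= lee_fin => /ltW.
apply/lee_addgt0Pr => e e0; rewrite -EFinD.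
have mdist0 := mdist_ge0 x y.
by apply: edist_fin => /=; rewrite ?ballEmdist/= ?ltrDl// ltr_wpDl.
Qed.

(* [ereal_sup set0] is -oo: the maximum with 0 makes the supremum of an empty
   family 0, and changes nothing otherwise. The infimum defining [edist_inf] is
   +oo on the empty set. *)
Definition lebesgue_fun (X : metricType R) (U : set (set X)) (x : X) : \bar R :=
  maxe 0%E (ereal_sup [set edist_inf (~` V) x | V in U]).

Definition lebesgue_number (X : metricType R) (U : set (set X)) : \bar R :=
  ereal_inf (range (lebesgue_fun U)).

Definition coarse (X : metricType R) (U : set (set X)) : Prop :=
  forall u : nat -> X, tends_to_infty u ->
    lebesgue_fun U (u k) @[k --> \oo] --> +oo%E.

Definition slowly_oscillating (X Y : metricType R) (f : X -> Y) : Prop :=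
  forall W : set (set Y), cover W id = [set: Y] ->
    (0 < lebesgue_number W)%E -> coarse [set f @^-1` V | V in W].

(* As above, the maximum with 0 only matters when [X] is empty. *)
Definition multiplicity (X : Type) (S : choiceType) (U : S -> set X) : \bar R :=
  maxe 0%E (ereal_sup (range (fun x => counting [set s | U s x]))).

End coarse.

Arguments multiplicity R {X S} U.

Section partition_of_unity.
Context (R : realType) (S : choiceType).

Record partition_of_unity (Z : Type) := PartitionOfUnity {
  pou_fun :> S -> Z -> R ;
  pou_ge0 : forall s z, 0 <= pou_fun s z ;
  pou_sum1 : forall z, \esum_(s in [set: S]) (pou_fun s z)%:E = 1%E }.

Lemma pou_summable (Z : Type) (phi : partition_of_unity Z) (z : Z) :
  `[< summable [set: S] (EFin \o phi^~ z) >].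
Proof.
apply/asboolP; rewrite /summable (eq_esum (b := fun s => (phi s z)%:E)).
  by rewrite pou_sum1 ltry.
by move=> s _ /=; rewrite ger0_norm// pou_ge0.
Qed.

Definition pou_ell1 (Z : Type) (phi : partition_of_unity Z) (z : Z) : ell1 R S :=
  Ell1 (pou_summable phi z).

Definition pou_continuous (Z : topologicalType) (phi : partition_of_unity Z) :=
  forall s, continuous (phi s).

Definition pou_slowly_oscillating (Z : metricType R)
  (phi : partition_of_unity Z) := slowly_oscillating (pou_ell1 phi).

Definition carr (Z : Type) (phi : partition_of_unity Z) (s : S) : set Z :=
  phi s @^-1` [set t | 0 < t].

End partition_of_unity.

(* Main.v *)
Require Import Defs.
From HB Require Import structures.
From mathcomp Require Import all_boot all_order all_algebra finmap.
From mathcomp Require Import all_classical all_reals all_analysis.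
From mathcomp Require Import ring lra.

Set Implicit Arguments.
Unset Strict Implicit.
Unset Printing Implicit Defensive.

Import Order.TTheory GRing.Theory Num.Theory.
Import numFieldNormedType.Exports.

Local Open Scope classical_set_scope.
Local Open Scope ring_scope.

(** Both notions at infinity reduce to statements about balls. A family is
    coarse when, for each radius [r], every point outside some bounded set has
    its [r]-ball inside a member of the family ([coarseP]). A map is slowly
    oscillating when, for all [r] and [e], its variation over [r]-balls centred
    outside some bounded set is less than [e] ([slowly_oscillatingP]).

    From a coarse cover to a continuous partition of unity ([pou_of_coarse]):
    normalize the functions measuring the distance to the complement of [U s].
    At most [m] of them are nonzero at a point and each is 1-Lipschitz, so the
    l1-distance between the families at [x] and [y] is at most [2 m d(x, y)],
    and that between the normalized ones at most [4 m d(x, y)] divided by the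
    sum at [x] ([bump_weight_dist]). Coarseness makes this sum large far
    away ([coarse_bump_sum]), so the variation over balls of fixed
    radius tends to 0. To keep the distances finite even if some [U s] is the
    whole space, a base point [x0] is removed from every [U s].

    From a slowly oscillating partition of unity back to a coarse cover
    ([coarse_of_pou]): at each point at most [m] of the functions are nonzero
    and they sum to 1, so some [phi s] is at least [1 / (m + 1)] there. Far
    away, [phi] varies by less than [1 / (m + 1)] over the [r]-ball, hence
    [phi s] stays positive on it and the ball lies in [U s]. *)

(** * Coarse families and slowly oscillating maps in terms of balls *)

Section coarse_families.
Context {R : realType}.
Implicit Types X Y : metricType R.

Lemma mbounded_ball X (x0 : X) (M : R) : mbounded [set x | mdist x x0 <= M].
Proof.
exists (M + M) => x y /= xM yM.
by rewrite (le_trans (metric_triangle x x0 y))// lerD// metric_sym.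
Qed.

Lemma mboundedU X (A B : set X) :
  mbounded A -> mbounded B -> mbounded (A `|` B).
Proof.
have [->|/set0P[a Aa]] := eqVneq A set0; first by rewrite set0U.
have [->|/set0P[b Bb]] := eqVneq B set0; first by rewrite setU0.
move=> [M AM] [N BN]; exists (M + mdist a b + N).
have M0 : 0 <= M by rewrite (le_trans _ (AM a a Aa Aa))// mdist_ge0.
have N0 : 0 <= N by rewrite (le_trans _ (BN b b Bb Bb))// mdist_ge0.
have ab0 := mdist_ge0 a b.
have AB x y : A x -> B y -> mdist x y <= M + mdist a b + N.
  move=> /AM/(_ Aa) xa /(BN _ _ Bb) by_.
  have := metric_triangle x a y; have := metric_triangle a b y; lra.
move=> x y [Ax|Bx] [Ay|By].
- by have := AM _ _ Ax Ay; lra.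
- exact: AB.
- by rewrite metric_sym; exact: AB.
- by have := BN _ _ Bx By; lra.
Qed.

Lemma mbounded_thickening X (A : set X) (r : R) :
  mbounded A -> mbounded [set x | exists2 a, A a & mdist a x < r].
Proof.
move=> [M AM]; exists (r + M + r) => x y [a Aa ax] [b Ab bY].
have := metric_triangle x a y; have := metric_triangle a b y.
by have := AM _ _ Aa Ab; rewrite (metric_sym x a); lra.
Qed.

Lemma tends_to_infty_notin X (u : nat -> X) (B : set X) :
  tends_to_infty u -> mbounded B -> \forall k \near \oo, ~ B (u k).
Proof.
move=> [x0 /cvgryPgt ux0] [M BM].
have [->|/set0P[b Bb]] := eqVneq B set0; first by apply: nearW => k [].
near=> k => /BM/(_ Bb); apply/negP; rewrite -ltNge.
have := metric_triangle (u k) b x0.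
suff : M + mdist b x0 < mdist (u k) x0 by lra.
by near: k; exact: ux0.
Unshelve. all: by end_near. Qed.

(** The distance to the complement of [V] is at least [r] exactly when [V]
    contains the open [r]-ball: this turns Lebesgue functions into statements
    about balls, with no extended reals left. *)
Lemma le_edist_infC X (V : set X) (x : X) (r : R) :
  (r%:E <= edist_inf (~` V) x)%E <-> forall y, mdist x y < r -> V y.
Proof.
split=> [rV y xyr|ballV].
  apply: contrapT => nVy; move: rV; apply/negP; rewrite -ltNge.
  rewrite (@le_lt_trans _ _ (mdist x y)%:E) ?lte_fin// -edist_mdist.
  by apply: ereal_inf_lbound; exists y.
apply: le_ereal_inf_tmp => _ [y nVy <-]; rewrite edist_mdist lee_fin leNgt.
by apply/negP => /ballV.
Qed.

Lemma lt_lebesgue_fun X (W : set (set X)) (x : X) (r : R) : 0 <= r ->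
  (r%:E < lebesgue_fun W x)%E ->
  exists2 V, W V & forall y, mdist x y < r -> V y.
Proof.
move=> r0; rewrite lt_max lte_fin [r < 0]ltNge r0/=.
move=> /ereal_sup_gt[_ [V WV <-]] rV.
by exists V => //; apply/le_edist_infC/ltW.
Qed.

Lemma le_lebesgue_fun X (W : set (set X)) (V : set X) (x : X) (r : R) :
  W V -> (forall y, mdist x y < r -> V y) -> (r%:E <= lebesgue_fun W x)%E.
Proof.
move=> WV /le_edist_infC rV; rewrite le_max; apply/orP; right.
by rewrite (le_trans rV)//; apply: ereal_sup_ubound; exists V.
Qed.

(** Negating the right-hand side gives a radius [r] and, outside every ball
    around a base point, a point whose [r]-ball lies in no member of [W];
    these points form a sequence that tends to infinity and contradicts
    coarseness. *)
Lemma coarseP X (W : set (set X)) : coarse W <->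
  forall r : R, exists2 B : set X, mbounded B &
    forall x, ~ B x -> exists2 V, W V & forall y, mdist x y < r -> V y.
Proof.
split=> [cW r|balls u uoo]; last first.
  apply/cvgeyPge => r; have [B Bbnd BW] := balls r.
  near=> k; have [|V WV rV] := BW (u k); last exact: le_lebesgue_fun rV.
  by near: k; exact: tends_to_infty_notin.
apply: contrapT => nB.
have [x0 _] : exists x0 : X, True.
  apply: contrapT => nX; apply: nB; exists set0; first by exists 0.
  by move=> x; exfalso; apply: nX; exists x.
have far (k : nat) : exists x : X, k%:R < mdist x x0 /\
    ~ exists2 V, W V & forall y, mdist x y < r -> V y.
  apply: contrapT => nfar; apply: nB.
  exists [set x | mdist x x0 <= k%:R]; first exact: mbounded_ball.
  move=> x /= /negP; rewrite -ltNge => kx; apply: contrapT => nV.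
  by apply: nfar; exists x.
have [u u_far] := choice far.
(* The maximum with 0 excludes the value 0 that the Lebesgue function takes
   when no member of [W] contributes. *)
have /cW/cvgeyPgt/(_ (Num.max 0 r)) : tends_to_infty u.
  exists x0; apply/cvgryPgt => M; near=> k.
  apply: lt_trans (u_far k).1; rewrite (lt_le_trans (truncnS_gt M))// ler_nat.
  by near: k; exact: nbhs_infty_ge.
move=> [k _ /(_ k (leqnn k))] /lt_lebesgue_fun[|V WV ballV].
  by rewrite le_max lexx.
apply: (u_far k).2; exists V => // y xyr; apply: ballV.
by rewrite lt_max xyr orbT.
Unshelve. all: by end_near. Qed.

(** Far away, [f] varies arbitrarily little on balls of any fixed radius. Such
    a modulus comes from testing [f] on the cover of [Y] by balls of radius
    [e / 2]; conversely, a cover of Lebesgue number larger than [e] has a member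
    around the [e]-ball of each [f x], hence a preimage containing the
    [r]-ball of [x]. *)
Lemma slowly_oscillatingP X Y (f : X -> Y) : slowly_oscillating f <->
  forall r e : R, 0 < e -> exists2 B : set X, mbounded B &
    forall x y, ~ B x -> mdist x y < r -> mdist (f x) (f y) < e.
Proof.
split=> [fso r e e0|osc W _].
  pose W : set (set Y) := range (fun y : Y => [set z | mdist y z < e / 2]).
  have e20 : 0 < e / 2 by rewrite divr_gt0.
  have Wcover : cover W id = [set: Y].
    apply/seteqP; split => // y _; exists [set z | mdist y z < e / 2].
      by exists y.
    by rewrite /= mdistxx.
  have W_gt0 : (0 < lebesgue_number W)%E.
    apply: (@lt_le_trans _ _ (e / 2)%:E); first by rewrite lte_fin.
    apply: le_ereal_inf_tmp => _ [y _ <-].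
    apply: (le_lebesgue_fun (V := [set z | mdist y z < e / 2])) => //.
    by exists y.
  (* The radius is made positive so that the ball contains [x] itself. *)
  have /coarseP/(_ (Num.max r 1))[B Bbnd BW] := fso W Wcover W_gt0.
  exists B => // x y /BW[_ [_ [z _ <-] <-]] ball_z xyr.
  have := ball_z x; have := ball_z y.
  rewrite /= mdistxx !lt_max xyr ltr01 orbT => /(_ isT) zy /(_ isT) zx.
  rewrite (le_lt_trans (metric_triangle _ z _))// (splitr e).
  by rewrite ltrD// metric_sym.
move=> lW; have [e e0 eW] : exists2 e : R, 0 < e & (e%:E < lebesgue_number W)%E.
  case: (lebesgue_number W) lW => [l| |]// l0; last by exists 1; rewrite ?ltry.
  exists (l / 2); first by rewrite divr_gt0// -lte_fin.
  by rewrite lte_fin ltr_pdivrMr// ltr_pMr ?ltr1n// -lte_fin.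
apply/coarseP => r; have [B Bbnd fB] := osc r e e0.
exists B => // x nBx.
have [|V WV ballV] := @lt_lebesgue_fun _ W (f x) e (ltW e0).
  by apply: lt_le_trans eW _; apply: ereal_inf_lbound; exists (f x).
by exists (f @^-1` V); [exists V|move=> y xyr; exact/ballV/fB].
Qed.

End coarse_families.

(** * Distance to a set *)

Section distance_to_set.
Context {R : realType} {X : metricType R}.
Implicit Types (B : set X) (x y : X).

Definition dist_to B x : R := fine (edist_inf B x).

Lemma dist_to_ge0 B x : 0 <= dist_to B x.
Proof. by rewrite fine_ge0// edist_inf_ge0. Qed.

Lemma dist_to_mem B x : B x -> dist_to B x = 0.
Proof. by move=> Bx; rewrite /dist_to edist_inf0. Qed.

Lemma edist_inf_fin_num B x : B !=set0 -> edist_inf B x \is a fin_num.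
Proof.
move=> [b Bb]; rewrite ge0_fin_numE ?edist_inf_ge0//.
rewrite (@le_lt_trans _ _ (mdist x b)%:E) ?ltry// -edist_mdist.
by apply: ereal_inf_lbound; exists b.
Qed.

Lemma dist_to_lipschitz B x y :
  B !=set0 -> `|dist_to B x - dist_to B y| <= mdist x y.
Proof.
move=> B0; have tri z t : dist_to B z <= mdist z t + dist_to B t.
  rewrite -lee_fin EFinD !fineK ?edist_inf_fin_num// -edist_mdist.
  exact: edist_inf_triangle.
have := tri x y; have := tri y x; rewrite (metric_sym y x) ler_norml.
by move=> ? ?; apply/andP; split; lra.
Qed.

Lemma le_dist_toC (V : set X) x r : ~` V !=set0 ->
  (forall y, mdist x y < r -> V y) -> r <= dist_to (~` V) x.
Proof.
by move=> V0 /le_edist_infC; rewrite -lee_fin fineK// edist_inf_fin_num.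
Qed.

End distance_to_set.

(** * Finitely supported families and the l1 metric *)

(** With sums [A] and [B], write
    [a i / A - b i / B = (a i - b i) / A + b i * (1 / A - 1 / B)]; each of the
    two parts has l1 norm at most that of [a - b] divided by [A]. The bound does
    not involve [B] because [|1 / A - 1 / B| * B = |A - B| / A]. *)
Lemma normalize_l1_le (R : realFieldType) (I : Type) (r : seq I)
    (a b : I -> R) :
    (forall i, 0 <= b i) ->
    0 < \sum_(i <- r) a i -> 0 < \sum_(i <- r) b i ->
  \sum_(i <- r) `|a i / \sum_(j <- r) a j - b i / \sum_(j <- r) b j| <=
  2 * (\sum_(i <- r) `|a i - b i|) / \sum_(i <- r) a i.
Proof.
move=> b0; set A := \sum_(i <- r) a i; set B := \sum_(i <- r) b i => A0 B0.
have AB : `|A^-1 - B^-1| * B <= (\sum_(i <- r) `|a i - b i|) / A.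
  have -> : A^-1 - B^-1 = - ((A - B) / (A * B)).
    by field; rewrite !gt_eqF.
  rewrite normrN normrM normfV (gtr0_norm (mulr_gt0 A0 B0)).
  have -> : `|A - B| / (A * B) * B = `|A - B| / A.
    by field; rewrite !gt_eqF.
  rewrite ler_pM2r ?invr_gt0// /A /B -sumrB.
  exact: ler_norm_sum.
rewrite mulr2n !mulrDl mul1r.
apply: le_trans (lerD (lexx _) AB).
rewrite mulr_suml mulr_sumr -big_split; apply: ler_sum => i _ /=.
have -> : a i / A - b i / B = (a i - b i) / A + (A^-1 - B^-1) * b i.
  by field; rewrite !gt_eqF.
rewrite (le_trans (ler_normD _ _))// !normrM (ger0_norm (b0 i)).
by rewrite normfV (gtr0_norm A0).
Qed.

Section finite_support.
Context {R : realType} {S : choiceType}.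
Implicit Types (K : {fset S}) (s : S).

Lemma esum_supported K (a : S -> R) : (forall s, 0 <= a s) ->
    (forall s, s \notin K -> a s = 0) ->
  \esum_(s in [set: S]) (a s)%:E = (\sum_(s <- K) a s)%:E.
Proof.
move=> a0 aK; rewrite (esumID [set` K]) => [|s _]; last by rewrite lee_fin.
rewrite [X in (_ + X)%E]esum1 => [|s [_ /= /negP/aK ->]//].
rewrite adde0 setTI esum_fset => [|//|s _]; last by rewrite lee_fin.
by rewrite fsbig_finite// set_fsetK sumEFin.
Qed.

Lemma mdist_ell1_supported K (u v : ell1 R S) :
    (forall s, s \notin K -> u s = 0) -> (forall s, s \notin K -> v s = 0) ->
  mdist u v = \sum_(s <- K) `|u s - v s|.
Proof.
move=> uK vK; rewrite /mdist/= /ell1_norm (esum_supported (K := K))//.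
by move=> s /[dup] /uK -> /vK ->; rewrite subrr normr0.
Qed.

(** Extracts from the extended-real multiplicity what the estimates use: index
    sets [K x] of uniformly bounded size containing every [s] with [x] in
    [U s]. *)
Lemma finite_multiplicity (X : Type) (U : S -> set X) :
    (multiplicity R U < +oo)%E ->
  exists (m : nat) (K : X -> {fset S}),
    (forall x, #|` K x| <= m)%N /\ forall s x, U s x -> s \in K x.
Proof.
rewrite /multiplicity; set M := maxe _ _ => M_lty.
have M_ge x : (counting [set s | U s x] <= M)%E.
  rewrite le_max; apply/orP; right; apply: ereal_sup_ubound; by exists x.
have fin x : finite_set [set s | U s x].
  apply: contrapT => inf; have := le_lt_trans (M_ge x) M_lty.
  by rewrite /counting asboolF.
exists (Num.truncn (fine M)), (fun x => fset_set [set s | U s x]).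
split=> [x|s x Usx]; last by rewrite in_fset_set// inE.
have M0 : (0 <= M)%E by rewrite le_max lexx.
have MK : (fine M)%:E = M by rewrite fineK// ge0_fin_numE.
rewrite truncn_ge_nat ?fine_ge0// -lee_fin MK.
by have := M_ge x; rewrite /counting asboolT.
Qed.

End finite_support.

Lemma lipschitz_continuous (R : realType) (Z : metricType R) (g : Z -> R)
    (C : R) :
  (forall x y, `|g x - g y| <= C * mdist x y) -> continuous g.
Proof.
move=> gC x; apply/cvgrPdist_lt => e e0.
have C0 : 0 < `|C| + 1 by rewrite ltr_wpDl.
apply/nbhs_ballP; exists (e / (`|C| + 1)); first by rewrite /= divr_gt0.
move=> y; rewrite ballEmdist/= ltr_pdivlMr// => xy.
rewrite (le_lt_trans (gC x y))// (le_lt_trans _ xy)// mulrC.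
by rewrite ler_wpM2l ?mdist_ge0// (le_trans (ler_norm C))// lerDl.
Qed.

(** * The partition of unity of a coarse cover *)

Section canonical_partition.
Context {R : realType} {X : metricType R} {S : choiceType}.
Variables (U : S -> set X) (x0 : X) (m : nat) (K : X -> {fset S}).
Hypothesis card_K : forall x, (#|` K x| <= m)%N.
Hypothesis UK : forall s x, U s x -> s \in K x.

(* Removing [x0] makes the complement nonempty, hence the distance to it finite;
   it caps that distance by the distance to [x0], which tends to infinity. *)
Let C s : set X := ~` (U s `\ x0).

Let C_neq0 s : C s !=set0.
Proof. by exists x0 => -[_]; apply. Qed.

Definition bump s x : R := dist_to (C s) x.
Definition bump_sum x : R := \sum_(s <- K x) bump s x.
Definition bump_weight s x : R := bump s x / bump_sum x.

Lemma bump_ge0 s x : 0 <= bump s x.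
Proof. exact: dist_to_ge0. Qed.

Lemma bump_out s x : ~ U s x -> bump s x = 0.
Proof. by move=> nU; apply: dist_to_mem => -[]. Qed.

Lemma bump_notin s x : s \notin K x -> bump s x = 0.
Proof. by move=> sK; apply: bump_out => /UK; exact/negP. Qed.

Lemma bump_sum_ge0 x : 0 <= bump_sum x.
Proof. by rewrite sumr_ge0// => s _; exact: bump_ge0. Qed.

(** Enlarging the index set lets the sums at two points be compared term by
    term. *)
Lemma bump_sumE x (L : {fset S}) : (K x `<=` L)%fset ->
  bump_sum x = \sum_(s <- L) bump s x.
Proof. by move=> KL; apply: big_fset_incl => // s _; exact: bump_notin. Qed.

Lemma le_bump_sum s x : bump s x <= bump_sum x.
Proof.
have [sK|/bump_notin ->] := boolP (s \in K x); last exact: bump_sum_ge0.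
rewrite /bump_sum (big_fsetD1 s)//= lerDl sumr_ge0// => t _.
exact: bump_ge0.
Qed.

(** At most [m + m] indices matter at [x] or at [y], and each contributes at
    most [mdist x y]. *)
Lemma bump_l1_lipschitz x y :
  \sum_(s <- (K x `|` K y)%fset) `|bump s x - bump s y| <=
  (m + m)%:R * mdist x y.
Proof.
apply: (@le_trans _ _ (\sum_(s <- (K x `|` K y)%fset) mdist x y)).
  by apply: ler_sum => s _; exact: dist_to_lipschitz.
rewrite big_const_seq count_predT iter_addr_0 -[leLHS]mulr_natl.
rewrite ler_wpM2r ?mdist_ge0// ler_nat.
by rewrite (leq_trans (leq_card_fsetU _ _).1)// leq_add.
Qed.

Lemma bump_sum_lipschitz x y :
  `|bump_sum x - bump_sum y| <= (m + m)%:R * mdist x y.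
Proof.
rewrite (bump_sumE (fsubsetUl (K x) (K y))) (bump_sumE (fsubsetUr (K x) (K y))).
rewrite -sumrB (le_trans (ler_norm_sum _ _ _))//.
exact: bump_l1_lipschitz.
Qed.

Lemma bump_weight_ge0 s x : 0 <= bump_weight s x.
Proof. by rewrite divr_ge0 ?bump_ge0 ?bump_sum_ge0. Qed.

Lemma bump_weight_notin s x : s \notin K x -> bump_weight s x = 0.
Proof. by move=> /bump_notin bs; rewrite /bump_weight bs mul0r. Qed.

Lemma bump_weight_sum1 x : 0 < bump_sum x ->
  \esum_(s in [set: S]) (bump_weight s x)%:E = 1%E.
Proof.
move=> F0; rewrite (esum_supported (K := K x)) => [|s|s]; last 2 first.
- exact: bump_weight_ge0.
- exact: bump_weight_notin.
by rewrite -mulr_suml divff// gt_eqF.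
Qed.

Lemma bump_weight_dist x y : 0 < bump_sum x -> 0 < bump_sum y ->
  \sum_(s <- (K x `|` K y)%fset) `|bump_weight s x - bump_weight s y| <=
  2 * ((m + m)%:R * mdist x y) / bump_sum x.
Proof.
move=> Fx Fy; rewrite /bump_weight.
have Ex := bump_sumE (fsubsetUl (K x) (K y)).
have Ey := bump_sumE (fsubsetUr (K x) (K y)).
move: (Fx) (Fy); rewrite Ex Ey => Gx Gy.
apply: le_trans (normalize_l1_le _ Gx Gy) _; first by move=> s; exact: bump_ge0.
by rewrite ler_pM2r ?invr_gt0// ler_pM2l// bump_l1_lipschitz.
Qed.

(** A single term suffices: if the [r]-ball at [x] lies in [U s] and misses
    [x0], then [bump s x] is at least [r]. *)
Lemma coarse_bump_sum : coarse (range U) ->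
  forall r, exists2 B, mbounded B & forall x, ~ B x -> r <= bump_sum x.
Proof.
move=> /coarseP cU r; have [B Bbnd BU] := cU r.
exists (B `|` [set x | mdist x x0 <= r]).
  by apply: mboundedU => //; exact: mbounded_ball.
move=> x /not_orP[nBx /negP]; rewrite -ltNge => rx.
have [_ [s _ <-] ballU] := BU x nBx.
apply: le_trans (le_bump_sum s x); apply: (le_dist_toC (C_neq0 s)) => y xyr.
split; first exact: ballU.
by move=> yx0; move: xyr; rewrite yx0 ltNge (ltW rx).
Qed.

(** [A] is chosen so that [bump_sum] is at least 1, hence invertible,
    off [A]. *)
Lemma pou_of_coarse : coarse (range U) ->
  exists A : set X, mbounded A /\
    exists phi : partition_of_unity R S (~` A),
      [/\ pou_continuous phi, pou_slowly_oscillating phi &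
          forall s, set_val @` carr phi s `<=` U s].
Proof.
move=> cU; have [A Abnd A1] := coarse_bump_sum cU 1.
have F0 (z : ~` A) : 0 < bump_sum (set_val z).
  by rewrite (lt_le_trans ltr01)// A1//; exact: (set_mem (valP z)).
exists A; split=> //.
pose phi := PartitionOfUnity (fun s (z : ~` A) => bump_weight_ge0 s (set_val z))
  (fun z => bump_weight_sum1 (F0 z)).
exists phi; split.
- move=> s z.
  have bump_cont : continuous (fun z : ~` A => bump s (set_val z)).
    apply: (lipschitz_continuous (C := 1)) => x y; rewrite mul1r.
    exact: dist_to_lipschitz.
  have sum_cont : continuous (fun z : ~` A => bump_sum (set_val z)).
    by apply: lipschitz_continuous => x y; exact: bump_sum_lipschitz.
  apply: (@continuousM _ _ (fun z : ~` A => bump s (set_val z))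
    (fun z : ~` A => (bump_sum (set_val z))^-1)); first exact: bump_cont.
  by apply: continuousV; [rewrite gt_eqF|exact: sum_cont].
- apply/slowly_oscillatingP => r e e0.
  (* Where [bump_sum] exceeds [4 m |r| / e], the bound of [bump_weight_dist] on
     pairs at distance less than [r] is below [e]. *)
  have [B [M BM] Br] := coarse_bump_sum cU (2 * ((m + m)%:R * `|r|) / e + 1).
  exists [set z | B (set_val z)]; first by exists M => x y; exact: BM.
  move=> x y /= /Br Fx xyr.
  rewrite (mdist_ell1_supported (K := (K (set_val x) `|` K (set_val y))%fset)).
  + apply: le_lt_trans (bump_weight_dist (F0 x) (F0 y)) _.
    rewrite ltr_pdivrMr// -ltr_pdivrMl// mulrC.
    apply: lt_le_trans Fx; rewrite ltr_pwDr// ler_pM2r ?invr_gt0//.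
    rewrite ler_pM2l// ler_wpM2l//; apply: ltW; apply: lt_le_trans xyr _.
    exact: ler_norm.
  + by move=> s; rewrite inE negb_or => /andP[+ _]; exact: bump_weight_notin.
  + by move=> s; rewrite inE negb_or => /andP[_ +]; exact: bump_weight_notin.
- move=> s _ [z /= zs <-]; apply: contrapT => /bump_out bz.
  by move: zs; rewrite /phi/= /carr/= /bump_weight bz mul0r ltxx.
Qed.

End canonical_partition.

(** * The converse, and the theorem *)

(** The excluded bounded set contains, besides [A] and the points where [phi]
    varies too much, the [r]-neighbourhood of [A]: this keeps the [r]-balls of
    the remaining points inside the domain of [phi]. *)
Lemma coarse_of_pou (R : realType) (X : metricType R) (S : choiceType)
    (U : S -> set X) (m : nat) (K : X -> {fset S}) (A : set X)
    (phi : partition_of_unity R S (~` A)) :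
    (forall x, (#|` K x| <= m)%N) -> (forall s x, U s x -> s \in K x) ->
    mbounded A -> pou_slowly_oscillating phi ->
    (forall s, set_val @` carr phi s `<=` U s) ->
  coarse (range U).
Proof.
move=> cardK UK Abnd /slowly_oscillatingP phi_so phiU.
have phi_gt0 s z : 0 < phi s z -> U s (set_val z).
  by move=> phi0; apply: phiU; exists z.
have phi_notin s z : s \notin K (set_val z) -> phi s z = 0.
  move=> sK; apply/eqP; rewrite eq_le pou_ge0 andbT leNgt.
  by apply: contra sK => /phi_gt0/UK.
apply/coarseP => r; have [|B [M BM] Bphi] := phi_so r (m.+1%:R^-1).
  by rewrite invr_gt0.
exists (A `|` [set x | exists2 a, A a & mdist a x < r] `|` set_val @` B).
  apply: mboundedU; first by apply: mboundedU => //; exact: mbounded_thickening.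
  by exists M => _ _ [x Bx <-] [y By <-]; exact: BM.
move=> x /not_orP[/not_orP[nAx far_x] nBx].
pose z : ~` A := exist _ x (mem_set nAx).
(* At most [m] terms below [1 / (m + 1)] have a sum smaller than 1. *)
have [s phis] : exists s, m.+1%:R^-1 <= phi s z.
  apply: contrapT => /forallNP small; have := pou_sum1 phi z.
  rewrite (esum_supported (K := K x)) => [[]|s|s]; last 2 first.
  - exact: pou_ge0.
  - exact: (phi_notin s z).
  apply/eqP; rewrite lt_eqF//.
  apply: (@le_lt_trans _ _ (\sum_(s <- K x) m.+1%:R^-1)).
    by apply: ler_sum => s _; rewrite ltW// ltNge; exact/negP/small.
  rewrite big_const_seq count_predT iter_addr_0 -[ltLHS]mulr_natl.
  by rewrite ltr_pdivrMr// mul1r ltr_nat ltnS.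
exists (U s); first by exists s.
move=> y xyr.
have nAy : ~ A y by move=> Ay; apply: far_x; exists y; rewrite // metric_sym.
pose w : ~` A := exist _ y (mem_set nAy).
apply: (phi_gt0 s w).
have /(Bphi z w)/(_ xyr) : ~ B z by move=> Bz; apply: nBx; exists z.
rewrite (mdist_ell1_supported (K := (K x `|` K y)%fset)); last 2 first.
- by move=> t; rewrite inE negb_or => /andP[+ _]; exact: (phi_notin t z).
- by move=> t; rewrite inE negb_or => /andP[_ +]; exact: (phi_notin t w).
have sK : s \in (K x `|` K y)%fset.
  rewrite inE; apply/orP; left; apply: contraT => /(phi_notin s z) phis0.
  by move: phis; rewrite phis0 leNgt invr_gt0 ltr0n.
rewrite (big_fsetD1 s)//= => close.
have : `|phi s z - phi s w| < m.+1%:R^-1.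
  by apply: le_lt_trans close; rewrite lerDl sumr_ge0.
by rewrite ltr_norml ltrBlDr => /andP[_ /(le_lt_trans phis)]; rewrite ltrDl.
Qed.

(** An empty space has no base point for the construction above, but every
    condition on a partition of unity then holds vacuously. *)
Lemma pou_of_empty (R : realType) (X : metricType R) (S : choiceType)
    (U : S -> set X) : (X -> False) ->
  exists A : set X, mbounded A /\
    exists phi : partition_of_unity R S (~` A),
      [/\ pou_continuous phi, pou_slowly_oscillating phi &
          forall s, set_val @` carr phi s `<=` U s].
Proof.
move=> X0; exists set0; split; first by exists 0 => x.
have Z0 (z : ~` (@set0 X)) : False := X0 (set_val z).
have phi_ge0 (s : S) (z : ~` (@set0 X)) : 0 <= (0 : R) by [].
exists (PartitionOfUnity phi_ge0 (fun z => False_ind _ (Z0 z))).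
split=> [s z||s x]; [by case: (Z0 z)| |by case: (X0 x)].
apply/slowly_oscillatingP => r e _.
by exists set0; [exists 0|move=> z; case: (Z0 z)].
Qed.

Theorem corollary7p10 (R : realType) (X : metricType R) (S : choiceType)
    (U : S -> set X)
    (U_cover : cover [set: S] U = [set: X])
    (U_finmult : (multiplicity R U < +oo)%E) :
  [<-> coarse (range U);
       exists A : set X, mbounded A /\
         exists phi : partition_of_unity R S (~` A),
           [/\ pou_continuous phi, pou_slowly_oscillating phi &
               forall s, set_val @` carr phi s `<=` U s];
       exists A : set X, mbounded A /\
         exists phi : partition_of_unity R S (~` A),
           pou_slowly_oscillating phi /\
           forall s, set_val @` carr phi s `<=` U s].
Proof.
have [m [K [card_K UK]]] := finite_multiplicity U_finmult.
tfae=> [cU|[A [Abnd [phi [_ so_phi phiU]]]]|[A [Abnd [phi [so_phi phiU]]]]].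
- have [[x0 _]|nX] := pselect (exists x0 : X, True).
    exact: (pou_of_coarse x0 card_K UK cU).
  by apply: pou_of_empty => x; apply: nX; exists x.
- by exists A; split=> //; exists phi.
- exact: (coarse_of_pou card_K UK Abnd so_phi phiU).
Qed.
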